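(* Let $A$ be the class of $(\text{co-diamond},\text{paw},\text{claw})$-free graphs. For all integers $a,b\ge 3$: \begin{itemize} \item $R_A(a,3)=2a-1$, \item $R_A(a,b)=\max\{2a,b\}$ for $b\ge 4$, \end{itemize} except for the following four numbers: $R_A(3,3)=6$ and $R_A(3,4)=R_A(3,5)=R_A(3,6)=7$.
   Context: All graphs are finite, undirected, without loops or multiple edges. The co-diamond is the disjoint union of one edge and two isolated vertices; the paw is a triangle together with one extra vertex adjacent to exactly one vertex of the triangle; the claw is the star $K_{1,3}$. A graph is $(H_1,\dots,H_k)$-free if it contains none of $H_1,\dots,H_k$ as an induced subgraph. For a class $A$ of graphs, $R_A(a,b)$ is the minimum $n$ such that every graph in $A$ with at least $n$ vertices has either a clique of size $a$ or an independent set of size $b$. *)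

(* Defs.v *)
From Stdlib Require List.
From mathcomp Require Import all_boot.

Set Implicit Arguments.
Unset Strict Implicit.
Unset Printing Implicit Defensive.

Record sgraph := SGraph {
  vertex :> finType;
  adj : rel vertex;
  adj_sym : symmetric adj;
  adj_irrefl : irreflexive adj }.

Definition induced_subgraph (H G : sgraph) : Prop :=
  exists2 f : H -> G, injective f & forall x y : H, adj (f x) (f y) = adj x y.

Definition free (Hs : seq sgraph) (G : sgraph) : Prop :=
  forall H, List.In H Hs -> ~ induced_subgraph H G.

Definition clique (G : sgraph) (K : {set G}) : Prop :=
  {in K &, forall x y, x != y -> adj x y}.

Definition independent (G : sgraph) (S : {set G}) : Prop :=
  {in S &, forall x y, ~~ adj x y}.

Definition ramsey_property (A : sgraph -> Prop) (a b n : nat) : Prop :=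
  forall G : sgraph, A G -> n <= #|G| ->
    (exists2 K : {set G}, clique K & #|K| = a) \/
    (exists2 S : {set G}, independent S & #|S| = b).

(* [ramsey_number A a b n] reads R_A(a, b) = n; being a relation, it also
   asserts that the minimum exists. *)
Definition ramsey_number (A : sgraph -> Prop) (a b n : nat) : Prop :=
  ramsey_property A a b n /\ forall m, ramsey_property A a b m -> n <= m.

Section EdgeList.
Variables (n : nat) (E : seq (nat * nat)).

Definition edge_rel : rel 'I_n := fun i j =>
  (i != j) && (((val i, val j) \in E) || ((val j, val i) \in E)).

Lemma edge_rel_sym : symmetric edge_rel.
Proof. by move=> i j; rewrite /edge_rel eq_sym orbC. Qed.

Lemma edge_rel_irrefl : irreflexive edge_rel.
Proof. by move=> i; rewrite /edge_rel eqxx. Qed.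

Definition edge_graph := SGraph edge_rel_sym edge_rel_irrefl.

End EdgeList.

Definition co_diamond : sgraph := edge_graph 4 [:: (0, 1)].
Definition paw : sgraph := edge_graph 4 [:: (0, 1); (0, 2); (1, 2); (2, 3)].
Definition claw : sgraph := edge_graph 4 [:: (0, 1); (0, 2); (0, 3)].

(* Main.v *)
(** Upper bounds: let [M] be a maximum clique of [G], with at least three
    vertices.  Since [G] is paw-free, a vertex outside [M] misses either exactly
    one vertex of [M] or all of them.  No vertex of [M] is the one missed by two
    outside vertices (claw or paw), and the outside vertices missing all of [M]
    form a clique [Z] (co-diamond), with at most one vertex if the first kind
    occurs.  Hence [#|G| <= 2 * #|M| + 1].  A triangle-free [G] with an edge
    [uv] has at most six vertices: [u] and [v] have degree at most 2 (claw), and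
    their common non-neighbours form a clique (co-diamond).

    Lower bounds: the cocktail party graph [K_{2,...,2}] for [b = 3], together
    with an isolated vertex for [b >= 4], the edgeless graph, and the cycles
    [C_5] and [C_6] for the four exceptional values. *)

Require Import Defs.
From mathcomp Require Import all_boot.
From mathcomp Require Import zify.

Set Implicit Arguments.
Unset Strict Implicit.
Unset Printing Implicit Defensive.

Notation ramsey_class := (free [:: co_diamond; paw; claw]).

(** * Cliques and independent sets of prescribed size *)

Lemma exists_subset_card (T : finType) (A : {set T}) k :
  k <= #|A| -> exists2 B : {set T}, B \subset A & #|B| = k.
Proof.
move=> leka; exists [set x in take k (enum A)].
  by apply/subsetP=> x; rewrite inE => /mem_take; rewrite mem_enum.
rewrite cardsE; have /card_uniqP -> := take_uniq k (enum_uniq A).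
by rewrite size_take_min -cardE; apply/minn_idPl.
Qed.

Lemma clique_subset (G : sgraph) (K L : {set G}) :
  L \subset K -> clique K -> clique L.
Proof. by move=> /subsetP sLK cK x y /sLK xK /sLK yK; apply: cK. Qed.

Lemma independent_subset (G : sgraph) (S T : {set G}) :
  T \subset S -> independent S -> independent T.
Proof. by move=> /subsetP sTS iS x y /sTS xS /sTS yS; apply: iS. Qed.

Lemma clique_of_size (G : sgraph) (K : {set G}) a :
  clique K -> a <= #|K| -> exists2 L : {set G}, clique L & #|L| = a.
Proof.
move=> cK /exists_subset_card[L sLK cardL]; exists L => //.
exact: clique_subset cK.
Qed.

Lemma independent_of_size (G : sgraph) (S : {set G}) b :
  independent S -> b <= #|S| -> exists2 T : {set G}, independent T & #|T| = b.
Proof.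
move=> iS /exists_subset_card[T sTS cardT]; exists T => //.
exact: independent_subset iS.
Qed.

Lemma adjC (G : sgraph) (x y : G) : adj x y = adj y x.
Proof. exact: adj_sym. Qed.

Lemma adjxx (G : sgraph) (x : G) : adj x x = false.
Proof. exact: adj_irrefl. Qed.

Lemma adj_neq (G : sgraph) (x y : G) : adj x y -> x != y.
Proof. by apply: contraTneq => ->; rewrite adjxx. Qed.

Lemma independent3 (G : sgraph) (x y z : G) :
  x != y -> y != z -> z != x -> ~~ adj x y -> ~~ adj y z -> ~~ adj z x ->
  exists2 S : {set G}, independent S & #|S| = 3.
Proof.
move=> nxy nyz nzx axy ayz azx; exists [set x; y; z].
  by move=> s t; rewrite !inE -!orbA => /or3P[] /eqP-> /or3P[] /eqP->;
     rewrite ?adjxx // adjC.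
by rewrite setUC cardsU1 cards2 !inE negb_or nzx eq_sym nyz nxy.
Qed.

Lemma clique3 (G : sgraph) (x y z : G) :
  adj x y -> adj y z -> adj z x -> exists2 K : {set G}, clique K & #|K| = 3.
Proof.
move=> axy ayz azx; exists [set x; y; z].
  by move=> s t; rewrite !inE -!orbA => /or3P[] /eqP-> /or3P[] /eqP->;
     rewrite ?eqxx // adjC.
by rewrite setUC cardsU1 cards2 !inE negb_or !adj_neq // adjC.
Qed.

(** * The three forbidden graphs as adjacency rules *)

Section Induced4.

Variables (G : sgraph) (x0 x1 x2 x3 : G) (E : seq (nat * nat)).
Let s := [:: x0; x1; x2; x3].

(** Pairs with [i < j] suffice: symmetry and irreflexivity of [adj] settle the others. *)
Lemma induced4 :
  uniq s ->
  {in gtn 4 &, forall i j, i < j ->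
     adj (nth x0 s i) (nth x0 s j) = ((i, j) \in E) || ((j, i) \in E)} ->
  induced_subgraph (edge_graph 4 E) G.
Proof.
move=> us adjs; exists (fun i : 'I_4 => nth x0 s i) => [i j /eqP | i j].
  by rewrite nth_uniq // => /eqP/val_inj.
rewrite /= /edge_rel -val_eqE /=; case: ltngtP => [ltij | ltji | ->] /=.
- by rewrite adjs // inE.
- by rewrite adjC adjs ?inE // orbC.
- exact: adjxx.
Qed.

End Induced4.

Section ForbiddenSubgraphs.

Variable G : sgraph.
Hypothesis freeG : ramsey_class G.

Let neq_adj (x y z : G) : adj x y -> ~~ adj z y -> x != z.
Proof. by move=> axy; apply: contraNneq => <-. Qed.

(** Otherwise [x y z w] induce a co-diamond with edge [xy]. Only [z != w] has to be assumed; the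
    other vertices are told apart by their adjacencies. *)
Lemma co_diamond_freeP (x y z w : G) :
  adj x y -> ~~ adj z x -> ~~ adj z y -> ~~ adj w x -> ~~ adj w y ->
  z != w -> adj z w.
Proof.
move=> axy azx azy awx awy nzw; apply: contraT => azw; exfalso.
have ayx : adj y x by rewrite adjC.
apply: (freeG (H := co_diamond)); first by left.
apply: (@induced4 _ x y z w).
  rewrite /= !inE !negb_or nzw (neq_adj axy azy) (neq_adj axy awy).
  by rewrite (neq_adj ayx azx) (neq_adj ayx awx) adj_neq.
move=> [|[|[|[|i]]]] [|[|[|[|j]]]] //= _ _ _.
all: by rewrite ?axy //; apply/negbTE; rewrite // adjC.
Qed.

(** Otherwise the triangle [xyz] with [w] pendant at [z] is an induced paw. *)
Lemma paw_freeP (x y z w : G) :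
  adj x y -> adj x z -> adj y z -> adj z w -> adj w x || adj w y.
Proof.
move=> axy axz ayz azw; apply: contraT => /norP[awx awy]; exfalso.
have ayx : adj y x by rewrite adjC.
apply: (freeG (H := paw)); first by right; left.
apply: (@induced4 _ x y z w).
  by rewrite /= !inE !negb_or (neq_adj axy awy) (neq_adj ayx awx) !adj_neq.
move=> [|[|[|[|i]]]] [|[|[|[|j]]]] //= _ _ _.
all: by rewrite ?axy //; apply/negbTE; rewrite // adjC.
Qed.

Lemma claw_freeP (c x y z : G) :
  adj c x -> adj c y -> adj c z -> x != y -> y != z -> z != x ->
  [|| adj x y, adj y z | adj z x].
Proof.
move=> acx acy acz nxy nyz nzx; apply: contraT => /norP[axy /norP[ayz azx]].
exfalso.
apply: (freeG (H := claw)); first by right; right; left.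
apply: (@induced4 _ c x y z).
  by rewrite /= !inE !negb_or nxy nyz (eq_sym x z) nzx !adj_neq.
move=> [|[|[|[|i]]]] [|[|[|[|j]]]] //= _ _ _.
all: by rewrite ?axy //; apply/negbTE; rewrite // adjC.
Qed.

End ForbiddenSubgraphs.

(** * Triangle-free graphs in the class *)

(** Among three neighbours of [u] some two are adjacent, as there is no claw, and they close a
    triangle with [u]. *)
Lemma triangle_free_degree (G : sgraph) (u : G) :
  ramsey_class G -> ~ (exists2 K : {set G}, clique K & #|K| = 3) ->
  #|[set x | adj u x]| <= 2.
Proof.
move=> freeG no3; rewrite leqNgt; apply/negP => /card_gt2P.
case=> x [y [z [[]]]]; rewrite !inE => ax ay az [nxy nyz nzx].
case/or3P: (claw_freeP freeG ax ay az nxy nyz nzx) => ast; apply: no3.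
- by apply: (clique3 ax ast); rewrite adjC.
- by apply: (clique3 ay ast); rewrite adjC.
- by apply: (clique3 az ast); rewrite adjC.
Qed.

Lemma triangle_free_card (G : sgraph) (u v : G) :
  ramsey_class G -> ~ (exists2 K : {set G}, clique K & #|K| = 3) ->
  adj u v -> #|G| <= 6.
Proof.
move=> freeG no3 auv.
(* The two neighbourhoods and [Z] cover the graph, with at most two vertices each: three vertices of
   [Z] would form a triangle by co-diamond-freeness. *)
pose Z := [set x | ~~ adj x u & ~~ adj x v].
have leZ : #|Z| <= 2.
  rewrite leqNgt; apply/negP => /card_gt2P[x [y [z [[]]]]]; rewrite !inE.
  move=> /andP[xu xv] /andP[yu yv] /andP[zu zv] [nxy nyz nzx]; apply: no3.
  by apply: (@clique3 _ x y z); apply: (co_diamond_freeP freeG auv).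
have sub : [set: G] \subset [set x | adj u x] :|: [set x | adj v x] :|: Z.
  by apply/subsetP=> x _; rewrite !inE (adjC x u) (adjC x v);
     case: (adj u x); case: (adj v x).
have := subset_leq_card sub; rewrite cardsT => /leq_trans; apply.
apply: leq_trans (leq_card_setU _ _) _; apply: (@leq_add _ _ 4 2) => //.
apply: leq_trans (leq_card_setU _ _) _.
by apply: (@leq_add _ _ 2 2); apply: triangle_free_degree.
Qed.

(** * Structure around a maximum clique *)

Section MaximumClique.

Variables (G : sgraph) (M : {set G}).
Hypotheses (freeG : ramsey_class G) (cliqueM : clique M) (gt2M : 2 < #|M|).
Hypothesis maxM : forall K : {set G}, clique K -> #|K| <= #|M|.

Let N := [set v | v \notin M & [exists x in M, adj v x]].
Let Z := [set v | v \notin M & [forall x in M, ~~ adj v x]].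

Lemma exists_two_others (m : G) :
  exists x y, [/\ x \in M, y \in M & [/\ x != m, y != m & x != y]].
Proof.
have : 1 < #|M :\ m|.
  by move: gt2M; rewrite (cardsD1 m M); case: (m \in M) => //= /ltnW.
case/card_gt1P=> x [y []]; rewrite !inE => /andP[xm xM] /andP[ym yM] nxy.
by exists x, y.
Qed.

(** By maximality [v] misses some [m] in [M]. If it missed a second vertex [y], then for a neighbour
    [x] of [v] in [M] the triangle [y m x] with [v] pendant at [x] would be a paw. *)
Lemma missed_vertex v : v \in N ->
  exists m, [/\ m \in M, ~~ adj v m & {in M, forall x, x != m -> adj v x}].
Proof.
rewrite inE => /andP[vM /exists_inP[x xM avx]].
case: (boolP [exists m in M, ~~ adj v m]) => [/exists_inP[m mM avm] | ].
  exists m; split=> // y yM nym; apply: contraT => avy; exfalso.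
  have nxy : x != y by apply: contraNneq avy => <-.
  have nxm : x != m by apply: contraNneq avm => <-.
  have axv : adj x v by rewrite adjC.
  have nyx : y != x by rewrite eq_sym.
  have nmx : m != x by rewrite eq_sym.
  have := paw_freeP freeG (cliqueM yM mM nym) (cliqueM yM xM nyx)
    (cliqueM mM xM nmx) axv.
  by rewrite (negbTE avy) (negbTE avm).
rewrite negb_exists_in => /forall_inP adjv.
have cK : clique (v |: M).
  move=> y z; rewrite !inE => /predU1P[-> | yM] /predU1P[-> | zM].
  - by rewrite eqxx.
  - by have := adjv z zM; rewrite negbK.
  - by have := adjv y yM; rewrite negbK adjC.
  - exact: cliqueM.
by have := maxM cK; rewrite cardsU1 vM ltnn.
Qed.

(** Sending each vertex of [N] to the vertex of [M] it misses is injective. *)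
Lemma card_partial_le : #|N| <= #|M|.
Proof.
(* The default [v] is never reached for [v] in [N]. *)
pose miss v := odflt v [pick m in M | ~~ adj v m].
have missP v : v \in N -> miss v \in M /\ {in M, forall x, (x != miss v) = adj v x}.
  case/missed_vertex=> m [mM avm adjv]; rewrite /miss.
  case: pickP => [m' /andP[m'M avm'] | /(_ m)]; last by rewrite mM avm.
  have -> : m' = m by apply: contraNeq avm' => /(adjv _ m'M).
  split=> // x xM /=; apply/idP/idP=> [/(adjv _ xM) // | ].
  by apply: contraTneq => ->.
rewrite -(card_in_imset (f := miss)) => [ | v w vN wN eqm].
  by apply/subset_leq_card/subsetP=> _ /imsetP[v /missP[mM _] ->].
have [mM adjv] := missP v vN; have [_ adjw] := missP w wN.
move: mM adjv adjw; rewrite -eqm; move: (miss v) => m mM adjv adjw.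
have [x [_ [xM _ [nxm _ _]]]] := exists_two_others m.
have axv : adj x v by rewrite adjC -adjv.
have axw : adj x w by rewrite adjC -adjw.
have axm : adj x m by apply: cliqueM.
have avm : adj v m = false by rewrite -adjv ?eqxx.
have awm : adj w m = false by rewrite -adjw ?eqxx.
have notM u : u \in N -> m != u.
  by rewrite inE => /andP[uM _]; apply: contraNneq uM => <-.
apply/eqP; apply: contraT => nvw; exfalso.
(* Here [x] sees [v], [w] and [m], while [v] and [w] both miss [m]: a paw if [v] and [w] are
   adjacent, a claw centred at [x] otherwise. *)
case: (boolP (adj v w)) => [avw | /negbTE nvw'].
  have avx : adj v x by rewrite adjC.
  have awx : adj w x by rewrite adjC.
  have := paw_freeP freeG avw avx awx axm.
  by rewrite !(adjC m) avm awm.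
have := claw_freeP freeG axv axw axm nvw.
rewrite (eq_sym w) !notM // => /(_ isT isT).
by rewrite nvw' awm adjC avm.
Qed.

Lemma clique_anticomplete : clique Z.
Proof.
have /card_gt1P[x [y [xM yM nxy]]] := ltnW gt2M.
move=> z w; rewrite !inE => /andP[_ /forall_inP az] /andP[_ /forall_inP aw].
by apply: (co_diamond_freeP freeG (cliqueM xM yM nxy)); auto.
Qed.

(** With [m] the vertex missed by [v], the triple [m v z] is independent: if [v] and [z] were
    adjacent, two other vertices of [M] would form with [v] a triangle having [z] pendant at [v]. *)
Lemma partial_anticomplete v z : v \in N -> z \in Z ->
  exists m, [/\ m \in M, m != v & [/\ ~~ adj v m, ~~ adj z v & ~~ adj z m]].
Proof.
move=> vN; case/missed_vertex: (vN) => m [mM avm adjv].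
rewrite inE => /andP[zM /forall_inP az]; exists m; split=> //.
  by move: vN; rewrite inE => /andP[vM _]; apply: contraNneq vM => <-.
split=> //; last exact: az.
have [x [y [xM yM [nxm nym nxy]]]] := exists_two_others m.
apply/negP; rewrite adjC => avz.
have axv : adj x v by rewrite adjC adjv.
have ayv : adj y v by rewrite adjC adjv.
have := paw_freeP freeG (cliqueM xM yM nxy) axv ayv avz.
by rewrite (negbTE (az x xM)) (negbTE (az y yM)).
Qed.

(** The sets [M], [N] and [Z] cover the graph. If [N] or [Z] is empty, the other has at most [#|M|]
    vertices; if neither is, there is an independent triple and [Z] is a single vertex. *)
Lemma card_max_clique :
  #|G| <= 2 * #|M| \/
  #|G| <= (2 * #|M|).+1 /\ exists2 S : {set G}, independent S & #|S| = 3.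
Proof.
have leG : #|G| <= #|M| + #|N| + #|Z|.
  rewrite -cardsT.
  have /subset_leq_card/leq_trans-> // : [set: G] \subset M :|: N :|: Z.
    apply/subsetP=> v _; rewrite !inE; case: (v \in M) => //=.
    rewrite -negb_exists_in; exact: orbN.
  apply: leq_trans (leq_card_setU _ _) _; rewrite leq_add2r.
  exact: leq_card_setU.
have leN := card_partial_le.
have leZ := maxM clique_anticomplete.
have [N0 | [v vN]] := set_0Vmem N.
  by left; move: leG; rewrite N0 cards0; lia.
have [Z0 | [z zZ]] := set_0Vmem Z.
  by left; move: leG; rewrite Z0 cards0; lia.
have [m [mM nmv [avm azv azm]]] := partial_anticomplete vN zZ.
right; split; last first.
  apply: (@independent3 _ m v z); rewrite // 1?adjC //.
    apply: contraTneq (vN) => ->; move: zZ; rewrite !inE.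
    by rewrite -negb_exists_in => /andP[-> /negbTE->].
  by apply: contraTneq zZ => ->; rewrite inE mM.
(* An edge [st] in [Z] is missed by both [m] and [v], which are non-adjacent: a co-diamond. *)
suff : #|Z| <= 1 by lia.
rewrite leqNgt; apply/negP => /card_gt1P[s [t [sZ tZ nst]]].
have ast := clique_anticomplete sZ tZ nst.
have avZ u : u \in Z -> ~~ adj v u.
  by move=> uZ; have [m' [_ _ [_]]] := partial_anticomplete vN uZ; rewrite adjC.
have amZ u : u \in Z -> ~~ adj m u.
  by rewrite inE => /andP[_ /forall_inP/(_ m mM)]; rewrite adjC.
have := co_diamond_freeP freeG ast (amZ s sZ) (amZ t tZ) (avZ s sZ) (avZ t tZ) nmv.
by rewrite adjC (negbTE avm).
Qed.

End MaximumClique.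

(** * Upper bounds *)

Lemma exists_max_clique (G : sgraph) :
  exists2 M : {set G}, clique M & forall K : {set G}, clique K -> #|K| <= #|M|.
Proof.
pose P (K : {set G}) := [forall x in K, forall y in K, (x != y) ==> adj x y].
have PP K : reflect (clique K) (P K).
  apply: (iffP forall_inP) => [h x y xK yK | h x xK].
    by have /forall_inP/(_ y yK)/implyP := h x xK.
  by apply/forall_inP=> y yK; apply/implyP/h.
have P0 : P set0 by apply/PP => x y; rewrite inE.
by case: (arg_maxnP (fun K : {set G} => #|K|) P0) => M /PP cM maxM;
   exists M => // K /PP/maxM.
Qed.

(** The cases are those of clique number at most 1, exactly 2, and at least 3. *)
Lemma ramsey_class_cases (G : sgraph) : ramsey_class G ->
  [\/ independent [set: G],
      #|G| <= 6 /\ ~ (exists2 K : {set G}, clique K & #|K| = 3) |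
      exists2 K : {set G}, clique K & #|G| <= 2 * #|K| \/
        #|G| <= (2 * #|K|).+1 /\ exists2 S : {set G}, independent S & #|S| = 3].
Proof.
move=> freeG; have [M cM maxM] := exists_max_clique G.
have [gt2M | leM2] := ltnP 2 #|M|.
  by apply: Or33; exists M => //; apply: card_max_clique.
have no3 : ~ (exists2 K : {set G}, clique K & #|K| = 3).
  by case=> K /maxM leKM cardK; move: leKM; rewrite cardK leqNgt ltnS leM2.
case: (boolP [exists u : G, exists v : G, adj u v]) => [/existsP[u /existsP[v auv]] | ].
  by apply: Or32; split=> //; apply: triangle_free_card auv.
rewrite negb_exists => /forallP no_adj; apply: Or31 => x y _ _.
by have := no_adj x; rewrite negb_exists => /forallP.
Qed.

(** Seven vertices exclude the triangle-free case with an edge. Otherwise [2 * a <= (2 * #|K|).+1],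
    which by parity gives [a <= #|K|]. *)
Lemma ramsey_upper a b n : 3 <= b -> b <= n -> 7 <= n -> 2 * a <= n ->
  ramsey_property ramsey_class a b n.
Proof.
move=> b3 lebn n7 lean G /ramsey_class_cases[iG | [G6 _] | [K cK leGK]] leG.
- by right; apply: (independent_of_size iG); rewrite cardsT (leq_trans lebn).
- by move: (leq_trans n7 leG); rewrite leqNgt ltnS G6.
- by left; apply: (clique_of_size cK); case: leGK => [|[]]; lia.
Qed.

(** The extra vertex in the bound [(2 * #|K|).+1] comes with an independent triple, so only
    [#|G| <= 2 * #|K|] matters. From [a >= 4], [2 * a - 1] exceeds 6. *)
Lemma ramsey_upper3 a : 4 <= a -> ramsey_property ramsey_class a 3 (2 * a - 1).
Proof.
move=> a4 G /ramsey_class_cases[iG | [G6 _] | [K cK leGK]] leG.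
- by right; apply: (independent_of_size iG); rewrite cardsT; lia.
- lia.
- case: leGK => [leGK | [_ i3]]; last by right.
  by left; apply: (clique_of_size cK); lia.
Qed.

Lemma ramsey_upper33 : ramsey_property ramsey_class 3 3 6.
Proof.
move=> G freeG leG; case: (ramsey_class_cases freeG) => [iG | [_ no3] | [K cK leGK]].
- by right; apply: (independent_of_size iG); rewrite cardsT; lia.
- right; have /card_gt0P[v _] : 0 < #|G| by apply: leq_trans leG.
  have ltN := triangle_free_degree v freeG no3.
  (* As [v] has at most two neighbours, [W] has at least three vertices; two of them are
     non-adjacent and form an independent triple with [v]. *)
  pose W := [set x | x != v & ~~ adj v x].
  have /card_gt2P[x [y [z [[]]]]] : 2 < #|W|.
    have sub : [set: G] \subset v |: ([set x | adj v x] :|: W).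
      by apply/subsetP=> x _; rewrite !inE; case: eqP; case: (adj v x).
    rewrite ltnNge; apply: contraL leG => leW; rewrite -leqNgt -cardsT.
    apply: leq_trans (subset_leq_card sub) _.
    apply: leq_trans (leq_card_setU _ _) _; rewrite cards1 ltnS.
    by apply: leq_trans (leq_card_setU _ _) _; apply: (@leq_add _ _ 2 2).
  rewrite !inE => /andP[nxv avx] /andP[nyv avy] /andP[nzv avz] [nxy nyz nzx].
  have nonadj_i3 s t : s != v -> ~~ adj v s -> t != v -> ~~ adj v t -> s != t ->
      ~~ adj s t -> exists2 S : {set G}, independent S & #|S| = 3.
    move=> nsv avs ntv avt nst ast.
    by apply: (@independent3 _ v s t) => //; [rewrite eq_sym | rewrite adjC].
  case: (boolP (adj x y)) => [axy | ]; last exact: nonadj_i3.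
  case: (boolP (adj y z)) => [ayz | ]; last exact: nonadj_i3.
  case: (boolP (adj z x)) => [azx | ]; last exact: nonadj_i3.
  by case: no3; apply: clique3 axy ayz azx.
- case: leGK => [leGK | [_ i3]]; last by right.
  by left; apply: (clique_of_size cK); lia.
Qed.

(** * Lower bounds from multipartite and edgeless graphs *)

Lemma ramsey_lower (A : sgraph -> Prop) (G : sgraph) a b m :
  A G -> (forall K : {set G}, clique K -> #|K| < a) ->
  (forall S : {set G}, independent S -> #|S| < b) ->
  ramsey_property A a b m -> #|G| < m.
Proof.
move=> AG noK noS Rm; rewrite ltnNge; apply/negP => leG.
case: (Rm G AG leG) => [[K /noK + cardK] | [S /noS + cardS]].
  by rewrite cardK ltnn.
by rewrite cardS ltnn.
Qed.

Section LabelledGraph.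

(* The complete multipartite graph on the fibres of [l] over [Some _], together
   with the isolated vertices labelled [None]. *)
Variables (T L : finType) (l : T -> option L).

Definition label_rel : rel T := fun x y => [&& l x != l y, l x & l y].

Lemma label_rel_sym : symmetric label_rel.
Proof. by move=> x y; rewrite /label_rel eq_sym (andbC (isSome _)). Qed.

Lemma label_rel_irrefl : irreflexive label_rel.
Proof. by move=> x; rewrite /label_rel eqxx. Qed.

Definition label_graph := SGraph label_rel_sym label_rel_irrefl.

Hypothesis fibre2 : forall i, #|[set x | l x == Some i]| <= 2.
Hypothesis fibre_None : #|[set x | l x == None]| <= 1.

(** The ends of an edge carry distinct labels, so a labelled vertex differs from one of them and is
    adjacent to it. *)
Lemma label_nonadj x y z :
  label_rel x y -> ~~ label_rel z x -> ~~ label_rel z y -> l z = None.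
Proof.
rewrite /label_rel; case: (l x) (l y) (l z) => [i|] [j|] [k|] //=; rewrite ?andbF //.
rewrite !andbT !negbK => nij /eqP ki /eqP kj.
by move: nij; rewrite -ki -kj eqxx.
Qed.

(** A co-diamond gives two isolated vertices. The pendant vertex of a paw misses an edge, hence is
    isolated, yet has a neighbour. The leaves of a claw would be three vertices in one fibre. *)
Lemma label_graph_free : ramsey_class label_graph.
Proof.
pose o k (ltk : k < 4) : 'I_4 := Ordinal ltk.
pose o0 := @o 0 isT; pose o1 := @o 1 isT; pose o2 := @o 2 isT; pose o3 := @o 3 isT.
move=> H memH [f injf adjf].
have {}adjf i j : label_rel (f i) (f j) = adj i j by apply: adjf.
move: memH f injf adjf => [<- | [<- | [<- | []]]] f injf adjf.
- have l2 : l (f o2) = None.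
    by apply: label_nonadj (adjf o0 o1) _ _; [rewrite (adjf o2 o0) | rewrite (adjf o2 o1)].
  have l3 : l (f o3) = None.
    by apply: label_nonadj (adjf o0 o1) _ _; [rewrite (adjf o3 o0) | rewrite (adjf o3 o1)].
  move: fibre_None; rewrite leqNgt => /negP; apply; apply/card_gt1P.
  by exists (f o2), (f o3); rewrite !inE l2 l3; split=> //; apply/negP => /eqP/injf.
- have l3 : l (f o3) = None.
    by apply: label_nonadj (adjf o0 o1) _ _; [rewrite (adjf o3 o0) | rewrite (adjf o3 o1)].
  by have := adjf o2 o3; rewrite /label_rel l3 !andbF.
- have := adjf o0 o1; have := adjf o0 o2; have := adjf o0 o3.
  have := adjf o1 o2; have := adjf o1 o3; rewrite /= /edge_rel /= /label_rel.
  case l1: (l (f o1)) => [i1|]; case l2: (l (f o2)) => [i2|];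
    case l3: (l (f o3)) => [i3|] //=; rewrite ?andbF //= ?andbT.
  move=> /negbFE/eqP[e13] /negbFE/eqP[e12] _ _ _.
  have := fibre2 i1; rewrite leqNgt => /negP; apply; apply/card_gt2P.
  exists (f o1), (f o2), (f o3); rewrite !inE l1 l2 l3 -e12 -e13 !eqxx.
  by split=> //; split; apply/negP => /eqP/injf.
Qed.

(** On a clique with at least two vertices all labels are present and distinct; [0 < #|L|] covers
    smaller cliques. *)
Lemma label_graph_clique (K : {set label_graph}) :
  0 < #|L| -> clique K -> #|K| <= #|L|.
Proof.
move=> L0 cK; have [leK1 | gtK1] := leqP #|K| 1; first exact: leq_trans leK1 L0.
have lab x : x \in K -> l x.
  have /card_gt1P[y [z [yK zK nyz]]] := gtK1 => xK.
  have [exy | nxy] := eqVneq x y.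
    by move: nyz; rewrite -exy => /(cK _ _ xK zK)/and3P[].
  by have /and3P[] := cK _ _ xK yK nxy.
rewrite -(card_in_imset (f := l)) => [ | x y xK yK exy]; last first.
  by apply: contraTeq isT => /(cK _ _ xK yK)/and3P[]; rewrite exy eqxx.
have inj_Some : injective (@Some L) by move=> i j [].
rewrite -cardsT -(card_imset setT inj_Some).
apply/subset_leq_card/subsetP=> _ /imsetP[x /lab lx ->].
by case: (l x) lx => // i _; apply: imset_f.
Qed.

(** An independent set meets at most one labelled fibre. *)
Lemma label_graph_independent (S : {set label_graph}) :
  independent S -> #|S| <= 2 + #|[set x | l x == None]|.
Proof.
move=> iS; case: (boolP [exists x in S, l x]) => [/exists_inP[x xS] | ].
  case lx: (l x) => [i|] // _.
  apply: leq_trans (_ : _ <= #|[set x | l x == Some i] :|: [set x | l x == None]|) _.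
    apply/subset_leq_card/subsetP=> y yS; have := iS _ _ xS yS.
    by rewrite /= /label_rel !inE lx; case: (l y) => //= j;
       rewrite andbT negbK => /eqP[->]; rewrite eqxx.
  by apply: leq_trans (leq_card_setU _ _) _; rewrite leq_add2r.
rewrite negb_exists_in => /forall_inP noS.
apply: leq_trans (leq_addl _ _); apply/subset_leq_card/subsetP=> x /noS.
by rewrite inE; case: (l x).
Qed.

End LabelledGraph.

Lemma card_fst_fibre (k : nat) (i : 'I_k) :
  #|[set p : 'I_k * bool | p.1 == i]| <= 2.
Proof.
rewrite -card_bool -(card_in_imset (f := snd)); first exact: max_card.
by move=> [x b] [y c]; rewrite !inE /= => /eqP-> /eqP-> ->.
Qed.

Lemma cocktail_lower k m : 0 < k ->
  ramsey_property ramsey_class k.+1 3 m -> 2 * k < m.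
Proof.
move=> k0; pose l (p : 'I_k * bool) := Some p.1.
have lNone : [set x | l x == None] = set0 by apply/setP=> x; rewrite !inE.
have -> : 2 * k = #|label_graph l|.
  by rewrite /= card_prod card_ord card_bool mulnC.
apply: ramsey_lower => [ | K cK | S /label_graph_independent ].
- apply: label_graph_free; last by rewrite lNone cards0.
  exact: card_fst_fibre.
- by rewrite ltnS -[k in _ <= k]card_ord; apply: (label_graph_clique (l := l));
    rewrite ?card_ord.
- by rewrite lNone cards0; apply; apply: card_fst_fibre.
Qed.

Lemma cocktail_isolated_lower k b m : 0 < k -> 4 <= b ->
  ramsey_property ramsey_class k.+1 b m -> (2 * k).+1 < m.
Proof.
move=> k0 b4; pose l (p : option ('I_k * bool)) := omap fst p.
have lNone : [set x | l x == None] = [set None].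
  by apply/setP=> -[p|]; rewrite !inE.
have lSome i : #|[set x | l x == Some i]| <= 2.
  have -> : [set x | l x == Some i] = Some @: [set p | p.1 == i].
    apply/setP=> -[p|]; rewrite !inE /=.
      by rewrite mem_imset ?inE //; apply: Some_inj.
    by apply/esym/negP=> /imsetP[].
  by rewrite card_imset; [apply: card_fst_fibre | apply: Some_inj].
have -> : (2 * k).+1 = #|label_graph l|.
  by rewrite /= card_option card_prod card_ord card_bool mulnC.
apply: ramsey_lower => [ | K cK | S /label_graph_independent ].
- by apply: label_graph_free => //; rewrite lNone cards1.
- by rewrite ltnS -[k in _ <= k]card_ord; apply: (label_graph_clique (l := l));
    rewrite ?card_ord.
- rewrite lNone cards1 => /(_ lSome) leS; exact: leq_ltn_trans leS b4.
Qed.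

Lemma edgeless_lower a b m : 3 <= a -> 0 < b ->
  ramsey_property ramsey_class a b m -> b <= m.
Proof.
move=> a3; case: b => // b _; pose l (_ : 'I_b) := @None 'I_0.
have -> : b < m = (#|label_graph l| < m) by rewrite /= card_ord.
apply: ramsey_lower => [ | K cK | S _].
(* The [None] fibre may be large here, so freeness is checked directly: each forbidden graph has the
   edge [01]. *)
- pose o k (ltk : k < 4) : 'I_4 := Ordinal ltk.
  move=> H [<- | [<- | [<- | []]]] [f _ adjf].
  + by have := adjf (@o 0 isT) (@o 1 isT).
  + by have := adjf (@o 0 isT) (@o 1 isT).
  + by have := adjf (@o 0 isT) (@o 1 isT).
- apply: leq_trans a3; rewrite ltnS; apply: (@leq_trans 1) => //.
  rewrite leqNgt; apply/negP => /card_gt1P[x [y [xK yK nxy]]].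
  by have := cK _ _ xK yK nxy.
- by rewrite ltnS; apply: leq_trans (max_card _) _; rewrite /= card_ord.
Qed.

(** * Lower bounds from small cycles, by exhaustive search *)

Fixpoint lists_below (k n : nat) : seq (seq nat) :=
  if k is k'.+1 then [seq i :: s | i <- iota 0 n, s <- lists_below k' n]
  else [:: [::]].

Lemma mem_lists_below n (s : seq nat) :
  all (gtn n) s -> s \in lists_below (size s) n.
Proof.
elim: s => //= i s IHs /andP[ltin /IHs sP].
by apply/allpairsP; exists (i, s); rewrite mem_iota.
Qed.

Definition edgeb (E : seq (nat * nat)) (i j : nat) :=
  (i != j) && (((i, j) \in E) || ((j, i) \in E)).

(** Embeddings are searched as lists of numbers, a form that evaluates by computation. *)
Definition induced_edgeb k E n E' :=
  has (fun s => uniq s &&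
    all (fun i => all (fun j =>
      edgeb E' (nth 0 s i) (nth 0 s j) == edgeb E i j) (iota 0 k)) (iota 0 k))
  (lists_below k n).

Lemma induced_edgeP k E n E' :
  induced_subgraph (edge_graph k E) (edge_graph n E') -> induced_edgeb k E n E'.
Proof.
case=> f injf adjf; pose s := [seq val (f i) | i <- enum 'I_k].
have size_s : size s = k by rewrite size_map size_enum_ord.
have nth_s (i : 'I_k) : nth 0 s i = f i.
  by rewrite (nth_map i) ?size_enum_ord // nth_ord_enum.
apply/hasP; exists s.
  rewrite -[X in lists_below X]size_s; apply: mem_lists_below.
  by apply/allP=> _ /mapP[i _ ->] /=.
rewrite map_inj_uniq ?enum_uniq => [|i j /val_inj/injf //] /=.
apply/allP=> i; rewrite mem_iota /= => ltik.
apply/allP=> j; rewrite mem_iota /= => ltjk.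
rewrite (nth_s (Ordinal ltik)) (nth_s (Ordinal ltjk)); apply/eqP.
exact: (adjf (Ordinal ltik) (Ordinal ltjk)).
Qed.

Lemma edgeless_induced (G : sgraph) (S : {set G}) k :
  independent S -> k <= #|S| -> induced_subgraph (edge_graph k [::]) G.
Proof.
move=> iS leS; pose f (i : 'I_k) : G := enum_val (widen_ord leS i).
exists f => [i j /enum_val_inj [] /val_inj // | i j].
by rewrite /= /edge_rel andbF; apply/negbTE/iS; apply: enum_valP.
Qed.

Lemma triangle_induced (G : sgraph) (K : {set G}) :
  clique K -> 3 <= #|K| ->
  induced_subgraph (edge_graph 3 [:: (0, 1); (0, 2); (1, 2)]) G.
Proof.
move=> cK leK; pose f (i : 'I_3) : G := enum_val (widen_ord leK i).
have injf : injective f by move=> i j /enum_val_inj [] /val_inj.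
exists f => // i j; have [-> | nij] := eqVneq i j; first by rewrite !adjxx.
rewrite cK ?enum_valP //; last by apply: contraNneq nij => /injf ->.
by move: i j nij => [[|[|[|i]]] ?] [[|[|[|j]]] ?].
Qed.

(** Clique and independence bounds become searches for a triangle and for an edgeless graph. The
    separate [b0] lets the search run on a numeral when [b] is a variable. *)
Lemma edge_graph_lower n E a b b0 m :
  ~~ induced_edgeb 4 [:: (0, 1)] n E ->
  ~~ induced_edgeb 4 [:: (0, 1); (0, 2); (1, 2); (2, 3)] n E ->
  ~~ induced_edgeb 4 [:: (0, 1); (0, 2); (0, 3)] n E ->
  ~~ induced_edgeb 3 [:: (0, 1); (0, 2); (1, 2)] n E ->
  ~~ induced_edgeb b0 [::] n E -> 3 <= a -> b0 <= b ->
  ramsey_property ramsey_class a b m -> n < m.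
Proof.
move=> no_cd no_paw no_claw no_K3 no_S a3 leb.
have -> : (n < m) = (#|edge_graph n E| < m) by rewrite /= card_ord.
apply: ramsey_lower => [H [<- | [<- | [<- | []]]] /induced_edgeP | K cK | S iS].
- exact/negP.
- exact/negP.
- exact/negP.
- rewrite ltnNge; apply: contra no_K3 => /(leq_trans a3)/(triangle_induced cK).
  exact: induced_edgeP.
- rewrite ltnNge; apply: contra no_S => /(leq_trans leb)/(edgeless_induced iS).
  exact: induced_edgeP.
Qed.

Definition cycle_edges n := (0, n.-1) :: [seq (i, i.+1) | i <- iota 0 n.-1].

Lemma C5_lower m : ramsey_property ramsey_class 3 3 m -> 5 < m.
Proof. by apply: (@edge_graph_lower 5 (cycle_edges 5) 3 3 3); vm_compute. Qed.

Lemma C6_lower b m : 4 <= b -> ramsey_property ramsey_class 3 b m -> 6 < m.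
Proof.
by move=> b4; apply: (@edge_graph_lower 6 (cycle_edges 6) 3 b 4); rewrite // ; vm_compute.
Qed.

(** * Matching upper and lower bounds *)

Theorem theorem8 :
  let A := free [:: co_diamond; paw; claw] in
  [/\ forall a : nat, 3 <= a -> a <> 3 -> ramsey_number A a 3 (2 * a - 1),
      forall a b : nat, 3 <= a -> 4 <= b ->
        (a, b) \notin [:: (3, 4); (3, 5); (3, 6)] ->
        ramsey_number A a b (maxn (2 * a) b),
      ramsey_number A 3 3 6 &
      [/\ ramsey_number A 3 4 7, ramsey_number A 3 5 7 &
          ramsey_number A 3 6 7]].
Proof.
move=> A; split.
- move=> a a3 na3; split=> [|m Rm]; first by apply: ramsey_upper3; lia.
  case: a a3 na3 Rm => // k a3 _ Rm.
  have := cocktail_lower (_ : 0 < k) Rm; lia.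
- move=> a b a3 b4 nab; split=> [|m Rm].
    have ge7 : 7 <= maxn (2 * a) b.
      (* Either [a >= 4], or [a = 3] and the excluded pairs leave [b >= 7]. *)
      by move: nab; rewrite !inE !xpair_eqE; lia.
    by apply: ramsey_upper => //; [exact: ltnW | exact: leq_maxr | exact: leq_maxl].
  rewrite geq_max (edgeless_lower a3 _ Rm) ?(ltn_trans _ b4) // andbT.
  case: a a3 {nab} Rm => // k a3 Rm.
  have := cocktail_isolated_lower (_ : 0 < k) b4 Rm; lia.
- by split=> [|m]; [apply: ramsey_upper33 | apply: C5_lower].
- by split; split=> [|m]; [exact: ramsey_upper | exact: C6_lower
    | exact: ramsey_upper | exact: C6_lower | exact: ramsey_upper | exact: C6_lower].
Qed.
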